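(* For each $1\le m\le8$ there are eighth roots of unity $\zeta_m^+,\zeta_m^-,\xi_m$ such that, for $|t|=1$, the distinct generic eigenvalues of $R(C_m(t))/\sqrt8$ are $$\zeta_m^+,\qquad\zeta_m^-,\qquad\xi_mt,\qquad-\xi_mt,$$ and each has generic multiplicity $16$. Hence, if $|t|=1$ and $t$ is not a root of unity, then for every $n\ge2$ the braid representation $\rho_{\widehat R,n}$ of $\mathcal B_n$ determined by $\widehat R=R(C_m(t))/\sqrt8$ has infinite image.
   Context: Let $w=e^{2\pi\mathrm i/8}$. On $\mathbb C^8$ with orthonormal basis $e_j$, $j\in\mathbb Z/8\mathbb Z$, let $Xe_j=e_{j+1}$, $Ze_j=w^je_j$. For $\mathbf a=[a_0,\dots,a_7]\in\mathbb C^8$ put $R(\mathbf a)=\sum_{k=0}^7a_k(X\otimes Z)^k\in\mathrm{End}(\mathbb C^8\otimes\mathbb C^8)$. Set $$I_{\alpha,\eta}(t)=[1,\alpha t,\eta,t,-1,\alpha t,-\eta,t],\qquad II_{\delta,\beta}(t)=[1,\delta t,\beta,-t,1,-\delta t,\beta,t]$$ and $$C_1=I_{-\mathrm i,-1},\ C_2=I_{-\mathrm i,1},\ C_3=I_{\mathrm i,-1},\ C_4=I_{\mathrm i,1},\ C_5=II_{-1,-\mathrm i},\ C_6=II_{-1,\mathrm i},\ C_7=II_{1,-\mathrm i},\ C_8=II_{1,\mathrm i}.$$ For $|t|=1$ the operator $R(C_m(t))/\sqrt8$ is a unitary Yang--Baxter operator. ''Generic'' refers to those $t$ for which the four displayed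 values are pairwise distinct; at exceptional $t$ where displayed values coincide, multiplicities add. $\mathcal B_n$ is the braid group on $n$ strands with Artin generators $\sigma_1,\dots,\sigma_{n-1}$; a Yang--Baxter operator $R$ on $D$ gives $\rho_{R,n}:\mathcal B_n\to\mathrm{GL}(D^{\otimes n})$, $\rho_{R,n}(\sigma_i)=I^{\otimes(i-1)}\otimes R\otimes I^{\otimes(n-i-1)}$. *)

(* Defs.v *)
From HB Require Import structures.
From mathcomp Require Import all_boot all_order all_algebra.
From mathcomp Require Import generic_quotient.
From mathcomp Require Import boolp classical_sets cardinality reals trigo.
From mathcomp Require Import complex mxtens.

Set Implicit Arguments.
Unset Strict Implicit.
Unset Printing Implicit Defensive.

Import Order.TTheory GRing.Theory Num.Theory.
Local Open Scope ring_scope.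

(* Braid group on n strands by the Artin presentation.  The generators are
   numbered from 0, so i : 'I_n.-1 stands for sigma_(i+1); in a word the letter
   (i, false) is the generator and (i, true) its inverse. *)
Definition braid_word (n : nat) := seq ('I_n.-1 * bool).

Inductive braid_eq (n : nat) : braid_word n -> braid_word n -> Prop :=
| braid_refl u : braid_eq u u
| braid_sym u v : braid_eq u v -> braid_eq v u
| braid_trans u v w : braid_eq u v -> braid_eq v w -> braid_eq u w
| braid_cat u u' v v' :
    braid_eq u u' -> braid_eq v v' -> braid_eq (u ++ v) (u' ++ v')
| braid_cancel i b : braid_eq [:: (i, b); (i, ~~ b)] [::]
| braid_far (i j : 'I_n.-1) : (i.+1 < j)%N ->
    braid_eq [:: (i, false); (j, false)] [:: (j, false); (i, false)]
| braid_adj (i j : 'I_n.-1) : j = i.+1 :> nat ->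
    braid_eq [:: (i, false); (j, false); (i, false)]
             [:: (j, false); (i, false); (j, false)].

Definition braid_rel (n : nat) : rel (braid_word n) :=
  fun u v => `[< braid_eq u v >].

Lemma braid_rel_refl n : reflexive (@braid_rel n).
Proof. by move=> u; apply/asboolP; apply: braid_refl. Qed.

Lemma braid_rel_sym n : symmetric (@braid_rel n).
Proof. by move=> u v; apply/asboolP/asboolP; apply: braid_sym. Qed.

Lemma braid_rel_trans n : transitive (@braid_rel n).
Proof.
by move=> v u w /asboolP uv /asboolP vw; apply/asboolP; apply: braid_trans vw.
Qed.

Canonical braid_equiv n :=
  EquivRel (@braid_rel n) (@braid_rel_refl n) (@braid_rel_sym n)
    (@braid_rel_trans n).

Definition braid_group (n : nat) := {eq_quot (@braid_rel n)}%qT.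

HB.instance Definition _ n := Choice.on (braid_group n).

Local Open Scope quotient_scope.

Lemma braid_piP n (u v : braid_word n) :
  braid_eq u v <-> \pi_(braid_group n) u = \pi_(braid_group n) v.
Proof.
split=> [uv | /eqmodP /asboolP //].
by apply/eqmodP/asboolP.
Qed.

Definition word_inv n (u : braid_word n) : braid_word n :=
  rev [seq (x.1, ~~ x.2) | x <- u].

Lemma word_invK n : involutive (@word_inv n).
Proof.
move=> u; rewrite /word_inv map_rev revK -map_comp -[RHS]map_id.
by apply: eq_map => -[i b] /=; rewrite negbK.
Qed.

Lemma word_inv_cat n (u v : braid_word n) :
  word_inv (u ++ v) = word_inv v ++ word_inv u.
Proof. by rewrite /word_inv map_cat rev_cat. Qed.

Lemma word_mulV n (u : braid_word n) : braid_eq (u ++ word_inv u) [::].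
Proof.
elim: u => [|[i b] u IHu]; first exact: braid_refl.
rewrite -cat1s word_inv_cat -catA [u ++ _]catA.
apply: (@braid_trans _ _ ([:: (i, b)] ++ ([::] ++ [:: (i, ~~ b)]))).
  by do 2?[apply: braid_cat => //]; apply: braid_refl.
exact: braid_cancel.
Qed.

Lemma word_mul_inv n (u : braid_word n) : braid_eq (word_inv u ++ u) [::].
Proof. by rewrite -{2}[u]word_invK; apply: word_mulV. Qed.

Lemma word_inv_eq n (u v : braid_word n) :
  braid_eq u v -> braid_eq (word_inv u) (word_inv v).
Proof.
move=> uv; apply: (@braid_trans _ _ (word_inv u ++ (v ++ word_inv v))).
  rewrite -{1}[word_inv u]cats0.
  by apply: braid_cat; [apply: braid_refl | apply/braid_sym/word_mulV].
rewrite catA -[word_inv v in X in braid_eq _ X]cat0s.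
apply: braid_cat; last exact: braid_refl.
apply: braid_trans (word_mul_inv u); apply: braid_cat; first exact: braid_refl.
exact: braid_sym.
Qed.

Definition braid_one n : braid_group n := \pi_(braid_group n) [::].
Definition braid_inv n (x : braid_group n) : braid_group n :=
  \pi_(braid_group n) (word_inv (repr x)).
Definition braid_mul n (x y : braid_group n) : braid_group n :=
  \pi_(braid_group n) (repr x ++ repr y).

Lemma repr_pi_eq n (u : braid_word n) :
  braid_eq (repr (\pi_(braid_group n) u)) u.
Proof. by apply/braid_piP; rewrite reprK. Qed.

Lemma braid_mul_pi n (u v : braid_word n) :
  braid_mul (\pi u) (\pi v) = \pi_(braid_group n) (u ++ v).
Proof. by apply/braid_piP/braid_cat; apply: repr_pi_eq. Qed.

Lemma braid_inv_pi n (u : braid_word n) :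
  braid_inv (\pi u) = \pi_(braid_group n) (word_inv u).
Proof. by apply/braid_piP/word_inv_eq/repr_pi_eq. Qed.

Lemma braid_mulA n : associative (@braid_mul n).
Proof.
move=> x y z; rewrite -[x]reprK -[y]reprK -[z]reprK.
by rewrite !braid_mul_pi catA.
Qed.

Lemma braid_mul1 n : left_id (@braid_one n) (@braid_mul n).
Proof. by move=> x; rewrite -[x]reprK braid_mul_pi. Qed.

Lemma braid_mulr1 n : right_id (@braid_one n) (@braid_mul n).
Proof. by move=> x; rewrite -[x]reprK braid_mul_pi cats0. Qed.

Lemma braid_mulVl n : left_inverse (@braid_one n) (@braid_inv n) (@braid_mul n).
Proof.
move=> x; rewrite -[x]reprK braid_inv_pi braid_mul_pi.
exact/braid_piP/word_mul_inv.
Qed.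

Lemma braid_mulVr n :
  right_inverse (@braid_one n) (@braid_inv n) (@braid_mul n).
Proof.
move=> x; rewrite -[x]reprK braid_inv_pi braid_mul_pi.
exact/braid_piP/word_mulV.
Qed.

HB.instance Definition _ n := isGroup.Build (braid_group n)
  (@braid_mulA n) (@braid_mul1 n) (@braid_mulr1 n) (@braid_mulVl n)
  (@braid_mulVr n).

Definition braid_gen n (i : 'I_n.-1) : braid_group n :=
  \pi_(braid_group n) [:: (i, false)].

(* With i counted from 0, the operator I^(i) (x) A (x) I^(n - i - 2) on the
   n-fold tensor power; castmx only identifies the dimensions. *)
Lemma local_dim (d n : nat) (i : 'I_n.-1) :
  (d ^ i * (d * d) * d ^ (n - i.+2) = d ^ n)%N.
Proof.
rewrite -[(d * d)%N]/(d ^ 2)%N -!expnD addn2 subnKC //.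
by have := ltn_ord i; case: n {i} (i : nat).
Qed.

Definition local_op (F : fieldType) (d n : nat) (A : 'M[F]_(d * d))
    (i : 'I_n.-1) : 'M[F]_(d ^ n) :=
  castmx (local_dim d i, local_dim d i)
    ((1%:M : 'M_(d ^ i)) *t A *t (1%:M : 'M_(d ^ (n - i.+2)))).

Definition is_braid_rep (F : fieldType) (d n : nat) (A : 'M[F]_(d * d))
    (rho : braid_group n -> 'M[F]_(d ^ n)) : Prop :=
  [/\ forall g, rho g \in unitmx,
      rho 1%g = 1%:M,
      forall g h, rho (g * h)%g = rho g *m rho h &
      forall i : 'I_n.-1, rho (braid_gen i) = local_op A i].

Local Open Scope complex_scope.

Definition w8 (R : realType) : R[i] :=
  cos (2 * pi / 8) +i* sin (2 * pi / 8).

(* Matrices act on column vectors: column j of X8 is e_(j+1), the sum being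
   taken in Z/8Z. *)
Definition X8 (R : realType) : 'M[R[i]]_8 := \matrix_(i, j) (i == j + 1)%:R.

Definition Z8 (R : realType) : 'M[R[i]]_8 :=
  diag_mx (\row_(j < 8) w8 R ^+ j).

Definition Rmx (R : realType) (a : 'rV[R[i]]_8) : 'M[R[i]]_(8 * 8) :=
  \sum_(k < 8) a 0 k *: (X8 R *t Z8 R) ^+ k.

Definition familyI (R : realType) (alpha eta t : R[i]) : 'rV[R[i]]_8 :=
  \row_(k < 8)
    [:: 1; alpha * t; eta; t; -1; alpha * t; - eta; t]`_k.

Definition familyII (R : realType) (delta beta t : R[i]) : 'rV[R[i]]_8 :=
  \row_(k < 8)
    [:: 1; delta * t; beta; - t; 1; - (delta * t); beta; t]`_k.

(* Only the indices 1 to 8 are meaningful. *)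
Definition familyC (R : realType) (m : nat) : R[i] -> 'rV[R[i]]_8 :=
  match m with
  | 1 => familyI (- 'i) (-1)
  | 2 => familyI (- 'i) 1
  | 3 => familyI 'i (-1)
  | 4 => familyI 'i 1
  | 5 => familyII (-1) (- 'i)
  | 6 => familyII (-1) 'i
  | 7 => familyII 1 (- 'i)
  | 8 => familyII 1 'i
  | _ => fun=> 0
  end.

Definition Rhat (R : realType) (m : nat) (t : R[i]) : 'M[R[i]]_(8 * 8) :=
  ((Num.sqrt 8)%:C)^-1 *: Rmx (familyC m t).

(* Both the algebraic and the geometric multiplicity of x are k.  The library's
   eigenspace consists of row vectors; its rank is n - \rank (A - x%:M), so it
   is also the dimension of the space of column eigenvectors. *)
Definition has_multiplicity (F : fieldType) (n : nat) (A : 'M[F]_n) (x : F)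
    (k : nat) : Prop :=
  mup x (char_poly A) = k /\ \rank (eigenspace A x) = k.

(* Main.v *)
(* Write T = X (x) Z, so that R(a) = p(T) for the polynomial p with coefficients
   a.  The Fourier matrix diagonalises X, hence T is diagonalised by a tensor
   product and has the eigenvalues w^(i+j), each 8th root of unity occurring 8
   times; the values p(w^j)/sqrt 8 are w, w^-1 and +-xi t, each for two values
   of j.
   The operators T_i on the tensor power have order 8, commute when they are
   far apart, and satisfy T_(i+1) T_i = w^-1 T_i T_(i+1).  Hence the braid
   relation for p(T_i), p(T_(i+1)) can be checked on the coefficients of the
   normally ordered monomials T_i^a T_(i+1)^b.
   The image is infinite because the powers of the first generator are told
   apart by the eigenvalue xi t. *)
Require Import Defs.
From mathcomp Require Import all_boot all_order all_algebra.
From mathcomp Require Import generic_quotient ring lra zify.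
From mathcomp Require Import boolp classical_sets cardinality reals trigo.
From mathcomp Require Import complex mxtens.

Import Order.TTheory GRing.Theory Num.Theory.
Local Open Scope ring_scope.

Set Implicit Arguments.
Unset Strict Implicit.

(** * Diagonalisable matrices *)

Lemma mup_prod_XsubC (F : fieldType) (I : Type) (r : seq I) (d : I -> F) x :
  mup x (\prod_(i <- r) ('X - (d i)%:P)) = (\sum_(i <- r) (d i == x))%N.
Proof.
elim: r => [|i r IHr]; first by rewrite !big_nil mupNroot // root1.
rewrite !big_cons mupM ?polyXsubC_eq0 ?IHr // ?monic_neq0 ?monic_prod_XsubC //.
by rewrite -['X - _]expr1 mup_XsubCX; case: eqP.
Qed.

Lemma mxrank_diag (F : fieldType) n (d : 'rV[F]_n) :
  \rank (diag_mx d) = (\sum_i (d 0%R i != 0%R))%N.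
Proof.
elim: n d => [|n IHn] d; first by rewrite big_ord0 flatmx0 mxrank0.
pose d' : 'rV_(1 + n) := d.
have -> : diag_mx d = diag_mx (row_mx (lsubmx d') (rsubmx d')).
  by rewrite hsubmxK.
rewrite diag_mx_row.
rewrite [LHS](rank_diag_block_mx (diag_mx (lsubmx d'))) IHn.
rewrite big_ord_recl; congr (_ + _)%N.
  rewrite rank_rV; congr (nat_of_bool (~~ _)); apply/eqP/eqP => [d0|d0].
    have /matrixP/(_ 0 0) := d0; rewrite /d' !mxE mulr1n => <-.
    by congr (d _ _); apply: val_inj.
  apply/matrixP => i j; rewrite !ord1 /d' !mxE mulr1n -[RHS]d0.
  by congr (d _ _); apply: val_inj.
by apply: eq_bigr => i _; rewrite /d' !mxE; congr (d _ _ != _); apply: val_inj.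
Qed.

Lemma char_poly_conj (F : fieldType) n (A B P : 'M[F]_n) :
  P \in unitmx -> A *m P = P *m B -> char_poly A = char_poly B.
Proof.
move=> uP AP.
(* The determinant of [P] is a nonzero constant polynomial, hence cancellable. *)
have uP' : \det (map_mx polyC P) != 0.
  by rewrite det_map_mx polyC_eq0 -unitfE -unitmxE.
apply: (mulIf uP'); rewrite [RHS]mulrC -!det_mulmx /char_poly_mx.
by rewrite mulmxBl mulmxBr -!map_mxM AP scalar_mxC.
Qed.

(** Conjugation by [P] preserves both the characteristic polynomial and the rank of [A - x%:M], so
    both multiplicities are read off the diagonal. *)
Lemma has_multiplicity_diag (F : fieldType) n (A P : 'M[F]_n) (d : 'rV[F]_n) x :
  P \in unitmx -> A *m P = P *m diag_mx d ->
  has_multiplicity A x (\sum_i (d 0%R i == x))%N.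
Proof.
move=> uP AP; split.
  rewrite (char_poly_conj uP AP) char_poly_trig ?diag_mx_is_trig //.
  rewrite mup_prod_XsubC; apply: eq_bigr => i _.
  by rewrite mxE eqxx mulr1n.
rewrite /eigenspace mxrank_ker.
have -> : \rank (A - x%:M) = \rank (diag_mx (d - const_mx x)).
  rewrite -(@mxrankMfree _ _ _ _ _ P) ?row_free_unit //.
  rewrite mulmxBl AP -scalar_mxC -mulmxBr.
  rewrite (eqmxMfull _ _) ?row_full_unit //.
  by rewrite raddfB /= diag_const_mx.
(* The dimension is written as a sum of ones: each diagonal entry then counts either for the rank or
   for the kernel. *)
rewrite mxrank_diag -[X in (X - _)%N]mul1n.
rewrite -[X in (_ * X)%N]card_ord mulnC -sum_nat_const.
set r := (\sum_i _)%N; apply/eqP; rewrite -(eqn_add2r r) subnK; last first.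
  by apply: leq_sum => i _; case: (_ != _).
rewrite -big_split /=; apply/eqP; apply: eq_bigr => i _.
by rewrite !mxE subr_eq0; case: eqP.
Qed.

Lemma eigenvalueE (F : fieldType) n (A : 'M[F]_n) x k :
  has_multiplicity A x k -> eigenvalue A x = (0 < k)%N.
Proof. by case=> _ <-; rewrite lt0n mxrank_eq0. Qed.

Lemma mx_exp_diag (F : fieldType) n (T P : 'M[F]_n) (d : 'rV[F]_n) k :
  T *m P = P *m diag_mx d -> T ^+ k *m P = P *m diag_mx (\row_i d 0 i ^+ k).
Proof.
move=> TP; elim: k => [|k IHk].
  rewrite mul1mx -[LHS]mulmx1 -diag_const_mx; congr (_ *m diag_mx _).
  by apply/rowP => i; rewrite !mxE.
rewrite exprSr -[_ * T]/(_ *m T) -mulmxA TP mulmxA IHk -mulmxA mulmx_diag.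
by congr (_ *m diag_mx _); apply/rowP => i; rewrite !mxE exprSr.
Qed.

Lemma mx_poly_diag (F : fieldType) n (T P : 'M[F]_n) (d : 'rV[F]_n) m
    (c : 'I_m -> F) :
  T *m P = P *m diag_mx d ->
  (\sum_k c k *: T ^+ k) *m P =
  P *m diag_mx (\row_i \sum_k c k * d 0 i ^+ k).
Proof.
move=> TP; have -> : diag_mx (\row_i \sum_k c k * d 0 i ^+ k) =
   \sum_k c k *: diag_mx (\row_i d 0 i ^+ k).
  apply/matrixP => i j; rewrite summxE !mxE -sumrMnl.
  by apply: eq_bigr => k _; rewrite !mxE mulrnAr.
rewrite mulmx_suml mulmx_sumr; apply: eq_bigr => k _.
by rewrite -scalemxAl -scalemxAr (mx_exp_diag k TP).
Qed.

(** * Tensor powers and local operators *)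

Lemma tensmx11 (F : comPzRingType) m n :
  (1%:M : 'M[F]_m) *t (1%:M : 'M[F]_n) = 1%:M.
Proof.
apply/matrixP => i j; case: (mxtens_indexP i) => i1 i2.
case: (mxtens_indexP j) => j1 j2; rewrite tensmxE !mxE -natrM mulnb.
by rewrite (can_eq (@mxtens_indexK m n)) xpair_eqE.
Qed.

Lemma tensmx_diag (F : comPzRingType) m n (d : 'rV[F]_m) (e : 'rV[F]_n) :
  diag_mx d *t diag_mx e =
  diag_mx (\row_k (d 0 (mxtens_unindex k).1 * e 0 (mxtens_unindex k).2)).
Proof.
apply/matrixP => i j; case: (mxtens_indexP i) => i1 i2.
case: (mxtens_indexP j) => j1 j2; rewrite tensmxE !mxE mxtens_indexK /=.
rewrite (can_eq (@mxtens_indexK m n)) xpair_eqE.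
by do 2!case: eqP => _ /=; rewrite ?mulr0n ?mulr0 ?mul0r ?mulr1n.
Qed.

Section TensorPower.
Variable F : fieldType.

Lemma castmx_irr m n (e e' : m = n) (A : 'M[F]_m) :
  castmx (e, e) A = castmx (e', e') A.
Proof. by rewrite (nat_irrelevance e e'). Qed.

Lemma castmx1 m n (e : m = n) : castmx (e, e) (1%:M : 'M[F]_m) = 1%:M.
Proof. by case: n / e. Qed.

Lemma castmx_mulmx m n (e : m = n) (A B : 'M[F]_m) :
  castmx (e, e) (A *m B) = castmx (e, e) A *m castmx (e, e) B.
Proof. by case: n / e. Qed.

Lemma tensmx_castl m m' n (e : m = m') (e' : (m * n = m' * n)%N)
    (A : 'M[F]_m) (B : 'M[F]_n) :
  castmx (e, e) A *t B = castmx (e', e') (A *t B).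
Proof. by case: m' / e e' => e'; rewrite !castmx_id. Qed.

Lemma tensmx_castr m n n' (e : n = n') (e' : (m * n = m * n')%N)
    (A : 'M[F]_m) (B : 'M[F]_n) :
  A *t castmx (e, e) B = castmx (e', e') (A *t B).
Proof. by case: n' / e e' => e'; rewrite !castmx_id. Qed.

(** Both bracketings number the triples of indices lexicographically, so only a cast separates
    them. *)
Lemma tensmxA m n p (e : (m * (n * p) = m * n * p)%N)
    (A : 'M[F]_m) (B : 'M[F]_n) (C : 'M[F]_p) :
  A *t B *t C = castmx (e, e) (A *t (B *t C)).
Proof.
apply/matrixP => i j; case: (mxtens_indexP i) => i12 i3.
case: (mxtens_indexP i12) => i1 i2; case: (mxtens_indexP j) => j12 j3.
case: (mxtens_indexP j12) => j1 j2; rewrite castmxE !tensmxE.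
have idx (x : 'I_m) y z : cast_ord (esym e) (mxtens_index (mxtens_index (x, y), z)) =
    mxtens_index (x, mxtens_index (y, z)).
  by apply: val_inj => /=; rewrite mulnDl addnA mulnA.
by rewrite !idx !tensmxE mulrA.
Qed.

Variable d : nat.
Implicit Type f : nat -> 'M[F]_d.

(** Taking [f] on all of [nat] avoids bounded indices when a product is split or its length is
    rewritten. *)
Fixpoint tens_prod f n : 'M[F]_(d ^ n) :=
  if n is n'.+1 then
    castmx (esym (expnSr d n'), esym (expnSr d n')) (tens_prod f n' *t f n')
  else 1%:M.

Lemma tens_prod_cast f m n (e : m = n) (e1 e2 : (d ^ m = d ^ n)%N) :
  castmx (e1, e2) (tens_prod f m) = tens_prod f n.
Proof. by case: n / e e1 e2 => e1 e2; rewrite castmx_id. Qed.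

Lemma eq_tens_prod f g n :
  (forall k, (k < n)%N -> f k = g k) -> tens_prod f n = tens_prod g n.
Proof.
elim: n => //= n IHn fg; rewrite fg // IHn // => k kn.
by apply: fg; apply: ltnW.
Qed.

Lemma tens_prod_scale f g (c : nat -> F) n :
  (forall k, (k < n)%N -> g k = c k *: f k) ->
  tens_prod g n = (\prod_(k < n) c k) *: tens_prod f n.
Proof.
elim: n => [|n IHn] fg /=; first by rewrite big_ord0 scale1r.
rewrite fg // IHn => [|k kn]; last exact/fg/ltnW.
rewrite big_ord_recr /=; apply/matrixP => i j.
by rewrite !(castmxE, mxE) mulrACA.
Qed.

Lemma tens_prod_mul f g n :
  tens_prod f n *m tens_prod g n = tens_prod (fun k => f k *m g k) n.
Proof.
elim: n => [|n IHn] /=; first exact: mul1mx.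
by rewrite -castmx_mulmx tensmx_mul IHn.
Qed.

Lemma tens_prod1 f n : (forall k, (k < n)%N -> f k = 1%:M) -> tens_prod f n = 1%:M.
Proof.
elim: n => //= n IHn f1; rewrite f1 // IHn ?tensmx11 ?castmx1 // => k kn.
exact/f1/ltnW.
Qed.

Lemma tens_prod_add f m n (e : (d ^ m * d ^ n = d ^ (m + n))%N) :
  castmx (e, e) (tens_prod f m *t tens_prod (fun k => f (m + k)%N) n) =
  tens_prod f (m + n).
Proof.
elim: n e => [|n IHn] e.
  rewrite /= tens_mx_scalar castmx_comp scale1r.
  by apply: tens_prod_cast; rewrite addn0.
have e1 : (d ^ m * d ^ n = d ^ (m + n))%N by rewrite expnD.
have e2 : (d ^ m * d ^ n * d = d ^ (m + n) * d)%N by rewrite e1.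
have e3 : (d ^ m * (d ^ n * d) = d ^ m * d ^ n.+1)%N by rewrite expnSr.
have e4 : (d ^ m * (d ^ n * d) = d ^ m * d ^ n * d)%N by rewrite mulnA.
have e5 : (d ^ (m + n) * d = d ^ (m + n.+1))%N by rewrite addnS expnSr.
transitivity (castmx (e5, e5) (tens_prod f (m + n) *t f (m + n)%N)); last first.
  have e6 : (d ^ (m + n).+1 = d ^ (m + n.+1))%N by rewrite addnS.
  rewrite -(tens_prod_cast f (esym (addnS m n)) e6 e6) /= castmx_comp.
  exact: castmx_irr.
rewrite /= -(IHn e1) (tensmx_castl e1 e2) (tensmxA e4) (tensmx_castr _ e3).
by rewrite !castmx_comp; apply: castmx_irr.
Qed.

(** In this form, local operators can be multiplied and compared one tensor factor at a time. *)
Lemma local_opE n (A B : 'M[F]_d) (i : 'I_n.-1) :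
  @local_op F d n (A *t B) i =
  tens_prod (fun k => if k == i then A else if k == i.+1 then B else 1%:M) n.
Proof.
rewrite /local_op; move: (local_dim d i) => e; set f := fun k => _.
have def_n : n = (i.+2 + (n - i.+2))%N by have := ltn_ord i; lia.
have -> : 1%:M = tens_prod f i.
  by rewrite tens_prod1 // => k ki; rewrite /f !ltn_eqF // ltnW.
have -> : 1%:M = tens_prod (fun k => f (i.+2 + k)%N) (n - i.+2).
  by rewrite tens_prod1 // => k _; rewrite /f !gtn_eqF //; lia.
have e2 : (d ^ i * (d * d) = d ^ i.+2)%N by rewrite !expnSr mulnA.
have -> : tens_prod f i *t (A *t B) = castmx (esym e2, esym e2) (tens_prod f i.+2).
  have e3 : (d ^ i * (d * d) = d ^ i * d * d)%N by rewrite mulnA.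
  have fi : f i = A by rewrite /f eqxx.
  have fi1 : f i.+1 = B by rewrite /f gtn_eqF // eqxx.
  rewrite /= fi fi1.
  have e4 : (d ^ i * d * d = d ^ i.+1 * d)%N by rewrite expnSr.
  rewrite (tensmx_castl _ e4) (tensmxA e3) !castmx_comp.
  by rewrite castmx_id.
have e4 : (d ^ i * (d * d) * d ^ (n - i.+2) = d ^ i.+2 * d ^ (n - i.+2))%N.
  by rewrite e2.
have e5 : (d ^ i.+2 * d ^ (n - i.+2) = d ^ (i.+2 + (n - i.+2)))%N by rewrite expnD.
have e6 : (d ^ (i.+2 + (n - i.+2)) = d ^ n)%N by rewrite -def_n.
rewrite -(tens_prod_cast f (esym def_n) e6 e6) -(tens_prod_add f e5).
rewrite (tensmx_castl _ (esym e4)) !castmx_comp; exact: castmx_irr.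
Qed.
End TensorPower.

Section LocalOp.
Variables (F : fieldType) (d n : nat) (i : 'I_n.-1).
Local Notation lop A := (@local_op F d n A i).

Lemma local_op1 : lop 1%:M = 1%:M.
Proof. by rewrite /local_op !tensmx11 castmx1. Qed.

Lemma local_opM A B : lop (A *m B) = lop A *m lop B.
Proof. by rewrite /local_op -castmx_mulmx !tensmx_mul !mulmx1. Qed.

Lemma local_opX A k : lop (A ^+ k) = lop A ^+ k.
Proof.
elim: k => [|k IHk]; first exact: local_op1.
by rewrite !exprS -IHk; apply: local_opM.
Qed.

Lemma local_op_sum m (c : 'I_m -> F) (A : 'I_m -> 'M[F]_(d * d)) :
  lop (\sum_k c k *: A k) = \sum_k c k *: lop (A k).
Proof.
apply/matrixP => x y; rewrite summxE castmxE !mxE summxE mulr_sumr mulr_suml.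
apply: eq_bigr => k _; rewrite [RHS]mxE /local_op castmxE !mxE; ring.
Qed.

Lemma local_op_unit A : A \in unitmx -> lop A \in unitmx.
Proof.
move=> uA; have : lop A *m lop (invmx A) = 1%:M.
  by rewrite -local_opM mulmxV ?local_op1.
by case/mulmx1_unit.
Qed.
End LocalOp.

(** * Polynomials in two q-commuting matrices *)

(** Each of the [i * j] exchanges of a [V] with a [U] contributes one factor [c]. *)
Lemma mx_qcommX (F : fieldType) N (U V : 'M[F]_N) c i j :
  V *m U = c *: (U *m V) ->
  V ^+ i *m U ^+ j = c ^+ (i * j) *: (U ^+ j *m V ^+ i).
Proof.
move=> VU.
have VUj k : V *m U ^+ k = c ^+ k *: (U ^+ k *m V).
  elim: k => [|k IHk]; first by rewrite mul1mx mulmx1 scale1r.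
  rewrite exprS -[U * _]/(U *m _) mulmxA VU -scalemxAl -mulmxA IHk.
  by rewrite -scalemxAr scalerA -exprS mulmxA.
elim: i => [|i IHi]; first by rewrite mul1mx mulmx1 scale1r.
rewrite exprS -[V * _]/(V *m _) -mulmxA IHi -scalemxAr !mulmxA VUj -scalemxAl.
by rewrite scalerA -exprD mulSn addnC.
Qed.

(* The two sides of the hypothesis are the coefficients of [U ^+ a *m V ^+ b] in
   the normally ordered expansions of the two sides of the conclusion. *)
Lemma mx_braid_of_qcomm (F : fieldType) N n (U V : 'M[F]_N) c (p : 'I_n.+1 -> F) :
    U ^+ n.+1 = 1 -> V ^+ n.+1 = 1 -> V *m U = c *: (U *m V) ->
    (forall a b : 'I_n.+1,
      p b * (\sum_k p (a - k) * p k * c ^+ (b * k)) =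
      p a * (\sum_k p (b - k) * p k * c ^+ (a * k))) ->
  let P (W : 'M[F]_N) := \sum_k p k *: W ^+ k in
  P U *m P V *m P U = P V *m P U *m P V.
Proof.
move=> U1 V1 VU pK P.
(* Addition in ['I_n.+1] is modulo [n.+1], which matches [W ^+ n.+1 = 1]. *)
have expD (W : 'M[F]_N) (i j : 'I_n.+1) : W ^+ n.+1 = 1 ->
    W ^+ i *m W ^+ j = W ^+ (i + j)%R.
  by move=> W1; rewrite -[_ *m _]exprD -[LHS](expr_mod _ W1).
have triple (W1 W2 W3 : 'M[F]_N) : P W1 *m P W2 *m P W3 =
    \sum_i \sum_j \sum_k (p i * p j * p k) *: (W1 ^+ i *m W2 ^+ j *m W3 ^+ k).
  rewrite -mulmxA /P mulmx_suml; apply: eq_bigr => i _.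
  rewrite mulmx_suml mulmx_sumr; apply: eq_bigr => j _.
  rewrite 2!mulmx_sumr; apply: eq_bigr => k _.
  rewrite -mulmxA; do !rewrite -?scalemxAl -?scalemxAr.
  rewrite !scalerA; congr (_ *: _); ring.
rewrite !triple.
transitivity (\sum_a \sum_b
    (p b * (\sum_k p (a - k) * p k * c ^+ (b * k))) *: (U ^+ a *m V ^+ b)).
  rewrite exchange_big [RHS]exchange_big; apply: eq_bigr => b _ /=.
  rewrite exchange_big /=.
  under [RHS]eq_bigr do rewrite mulr_sumr scaler_suml.
  rewrite [RHS]exchange_big; apply: eq_bigr => k _ /=.
  (* The term [U ^+ i *m V ^+ b *m U ^+ k] contributes to [U ^+ a *m V ^+ b] for [a = i + k], with
     the factor [c ^+ (b * k)]. *)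
  rewrite (reindex (fun a => a - k)); last first.
    by exists (fun a => a + k) => a _; rewrite (subrK, addrK).
  apply: eq_bigr => a _; rewrite -mulmxA (mx_qcommX _ _ VU) -scalemxAr scalerA.
  rewrite mulmxA expD // subrK; congr (_ *: _); ring.
transitivity (\sum_a \sum_b
    (p a * (\sum_k p (b - k) * p k * c ^+ (a * k))) *: (U ^+ a *m V ^+ b)).
  by apply: eq_bigr => a _; apply: eq_bigr => b _; rewrite pK.
rewrite [RHS]exchange_big; apply: eq_bigr => a _ /=.
under eq_bigr do rewrite mulr_sumr scaler_suml.
rewrite exchange_big; apply: eq_bigr => i _ /=.
rewrite [RHS](reindex (fun b => b - i)); last first.
  by exists (fun b => b + i) => b _; rewrite (subrK, addrK).
apply: eq_bigr => b _; rewrite (mx_qcommX _ _ VU) -scalemxAl scalerA -mulmxA.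
rewrite expD // (addrC i) subrK (mulnC a); congr (_ *: _); ring.
Qed.

(** * The families of coefficients *)

(* The coefficients of C_m, with w^2 for the imaginary unit. *)
Definition family_coef (F : fieldType) (w t : F) (m : nat) : seq F :=
  let I a e := [:: 1; a * t; e; t; -1; a * t; - e; t] in
  let II d b := [:: 1; d * t; b; - t; 1; - (d * t); b; t] in
  match m with
  | 1 => I (- w ^+ 2) (-1)
  | 2 => I (- w ^+ 2) 1
  | 3 => I (w ^+ 2) (-1)
  | 4 => I (w ^+ 2) 1
  | 5 => II (-1) (- w ^+ 2)
  | 6 => II (-1) (w ^+ 2)
  | 7 => II 1 (- w ^+ 2)
  | 8 => II 1 (w ^+ 2)
  | _ => [::]
  end.

(** With [c = w ^+ 7], the inverse of [w], this is the coefficient condition of [mx_braid_of_qcomm].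
    Each case is a polynomial identity in [t] and [w] modulo [w ^+ 4 = -1]; for [m] outside 1 to 8
    all coefficients are the default 0. *)
Lemma family_coef_braid (F : fieldType) (w t : F) m (a b : 'I_8) : w ^+ 4 = -1 ->
  let p k := (family_coef w t m)`_k in
  p b * \sum_(k < 8) p (a - k)%R * p k * (w ^+ 7) ^+ (b * k) =
  p a * \sum_(k < 8) p (b - k)%R * p k * (w ^+ 7) ^+ (a * k).
Proof.
move=> w4 p.
have c7 : w ^+ 7 = - w ^+ 3 by rewrite (exprD w 4 3) w4; ring.
rewrite {}/p !big_ord_recl !big_ord0 c7.
case: a => [[|[|[|[|[|[|[|[|//]]]]]]]] ha];
case: b => [[|[|[|[|[|[|[|[|//]]]]]]]] hb];
case: m => [|[|[|[|[|[|[|[|[|m]]]]]]]]] /=.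
all: ring: w4.
Qed.

(* xi_m is w ^ phase_exp m. *)
Definition phase_exp (m : nat) := nth 0%N [:: 0; 7; 7; 1; 1; 2; 2; 0; 0]%N m.

Definition eig_list (F : fieldType) (w t : F) m : seq F :=
  [:: w; w ^+ 7; w ^+ phase_exp m * t; - (w ^+ phase_exp m * t)].

(* The j-th entry is the position in [eig_list w t m] of the eigenvalue coming
   from w ^ j. *)
Definition eig_index (m : nat) : seq nat :=
  nth [::] [:: [::]; [:: 2; 1; 2; 0; 3; 1; 3; 0]; [:: 2; 0; 2; 1; 3; 0; 3; 1];
    [:: 2; 1; 3; 0; 3; 1; 2; 0]; [:: 2; 0; 3; 1; 3; 0; 2; 1];
    [:: 1; 3; 0; 3; 1; 2; 0; 2]; [:: 0; 3; 1; 3; 0; 2; 1; 2];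
    [:: 1; 2; 0; 3; 1; 3; 0; 2]; [:: 0; 2; 1; 3; 0; 3; 1; 2]] m.

(** The factor [2 * (w - w ^+ 3)] is an algebraic form of the square root of 8, so that every case
    can be settled by [ring] modulo [w ^+ 4 = -1]. *)
Lemma family_coef_value (F : fieldType) (w t : F) m (j : 'I_8) :
  (1 <= m <= 8)%N -> w ^+ 4 = -1 ->
  \sum_(k < 8) (family_coef w t m)`_k * (w ^+ j) ^+ k =
  2 * (w - w ^+ 3) * (eig_list w t m)`_(nth 0%N (eig_index m) j).
Proof.
move=> hm w4; rewrite /eig_list /phase_exp !big_ord_recl !big_ord0.
case: m hm => [|[|[|[|[|[|[|[|[|m]]]]]]]]] //= _;
case: j => [[|[|[|[|[|[|[|[|//]]]]]]]] hj] /=.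
all: ring: w4.
Qed.

(** * Spectrum of the Yang-Baxter operators *)

Section Roots.
Variable R : realType.
Local Open Scope complex_scope.

(** For x = pi/4, sin (2x) = 1 forces (cos x - sin x)^2 = 0, so both are equal, nonnegative and of
    square 1/2. The radical is the one that normalises [Rhat]. *)
Lemma cos_sin_pi4 : cos (2 * pi / 8) = Num.sqrt 8 / 4 :> R /\
  sin (2 * pi / 8) = Num.sqrt 8 / 4 :> R.
Proof.
set x : R := 2 * pi / 8.
have x2 : x + x = pi / 2 by rewrite /x; field.
have /eqP c2 := cosD x x; have /eqP s2 := sinD x x.
rewrite x2 cos_pihalf in c2; rewrite x2 sin_pihalf in s2.
have c0 : 0 <= cos x.
  by apply: cos_ge0_pihalf; have := pi_gt0 R; rewrite /x; lra.
have cs : cos x = sin x.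
  apply/eqP; rewrite -subr_eq0 -sqrf_eq0; apply/eqP.
  have := cos2Dsin2 x; move/eqP: s2 => s2 cs2.
  have -> : (cos x - sin x) ^+ 2 = cos x ^+ 2 + sin x ^+ 2 -
     (sin x * cos x + cos x * sin x) by ring.
  by rewrite -s2 cs2 subrr.
rewrite -cs; suff -> : (8 : R) = (cos x * 4) ^+ 2.
  by split; rewrite sqrtr_sqr ger0_norm ?mulr_ge0// mulfK ?pnatr_eq0.
have := cos2Dsin2 x; rewrite -cs => c1.
have -> : (cos x * 4) ^+ 2 = 16 * cos x ^+ 2 by ring.
lra.
Qed.

Lemma w8_sqr : w8 R ^+ 2 = 'i.
Proof.
rewrite expr2 /w8; have [-> ->] := cos_sin_pi4.
have r8 : Num.sqrt 8 ^+ 2 = 8 :> R by rewrite sqr_sqrtr.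
by apply/eqP; rewrite eq_complex /=; apply/andP; split; apply/eqP; nra.
Qed.

Lemma w8_exp4 : w8 R ^+ 4 = -1.
Proof. by rewrite (exprM _ 2 2) w8_sqr sqr_i. Qed.

Lemma sqrt8_w8 : (Num.sqrt 8)%:C = 2 * (w8 R - w8 R ^+ 3).
Proof.
rewrite exprS w8_sqr /w8; have [-> ->] := cos_sin_pi4.
by apply/eqP; rewrite eq_complex /=; apply/andP; split; apply/eqP; nra.
Qed.

Lemma familyCE m (t : R[i]) (k : 'I_8) :
  familyC m t 0 k = (family_coef (w8 R) t m)`_k.
Proof.
case: m => [|[|[|[|[|[|[|[|[|m]]]]]]]]];
  by rewrite /familyC /family_coef ?mxE ?nth_nil //= ?w8_sqr.
Qed.
End Roots.

(** The order divides 8; a proper divisor of 8 divides 4, which would give 1 = -1. *)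
Lemma root8_primitive (F : fieldType) (w : F) :
  (2 : F) != 0 -> w ^+ 4 = -1 -> 8.-primitive_root w.
Proof.
move=> two0 w4.
have w8 : w ^+ 8 = 1 by rewrite (exprM w 4 2) w4 sqrrN expr1n.
have [m prim_m m8] := prim_order_exists (isT : 0 < 8)%N w8.
case: (eqVneq m 8%N) => [<- // | m'8].
have : (m %| 4)%N.
  have : m \in divisors 8 by rewrite -dvdn_divisors.
  by rewrite !inE (negPf m'8) orbF; do 2?[case/orP]; move/eqP->.
rewrite (prim_order_dvd prim_m) w4 => /eqP w4'; case/eqP: two0.
by rewrite mulr2n -{1}w4' addNr.
Qed.

Section Spectrum.
Variable R : realType.
Local Notation w := (w8 R).

Lemma w8_prim : 8.-primitive_root w.
Proof. by apply: root8_primitive; rewrite ?pnatr_eq0 ?w8_exp4. Qed.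

(** As [w ^+ 7] is the inverse of [w], the entry at [(i, j)] is w^(-ij), and column [j] is an
    eigenvector of [X8] for [w ^+ j]. *)
Definition fourier8 : 'M[R[i]]_8 := Vandermonde 8 (\row_j w ^+ (7 * j)).

Lemma fourier8_unit : fourier8 \in unitmx.
Proof.
rewrite unitmxE det_Vandermonde unitfE.
apply/prodf_neq0 => i _; apply/prodf_neq0 => j lt_ij.
rewrite !mxE subr_eq0 (eq_prim_root_expr w8_prim).
move: lt_ij; case: i => [[|[|[|[|[|[|[|[|//]]]]]]]] ?];
by case: j => [[|[|[|[|[|[|[|[|//]]]]]]]] ?].
Qed.

Lemma X8_fourier : X8 R *m fourier8 = fourier8 *m diag_mx (\row_j w ^+ j).
Proof.
apply/matrixP => i j; rewrite mul_mx_diag !mxE (bigD1 (i - 1)) //=.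
rewrite big1 => [|k nk]; last first.
  rewrite !mxE; case: eqP => [ik|]; last by rewrite mul0r.
  by case/eqP: nk; rewrite ik addrK.
rewrite !mxE subrK eqxx mul1r addr0 -!exprM -exprD.
apply/eqP; rewrite (eq_prim_root_expr w8_prim).
case: i => [[|[|[|[|[|[|[|[|//]]]]]]]] ?];
by case: j => [[|[|[|[|[|[|[|[|//]]]]]]]] ?].
Qed.

Definition weyl8 : 'M[R[i]]_(8 * 8) := X8 R *t Z8 R.

Lemma weyl8_diag : weyl8 *m (fourier8 *t 1%:M) = (fourier8 *t 1%:M) *m
  diag_mx (\row_k w ^+ ((mxtens_unindex k).1 + (mxtens_unindex k).2)).
Proof.
rewrite /weyl8 tensmx_mul X8_fourier mulmx1 -[Z8 R]mul1mx -tensmx_mul tensmx_diag.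
by congr (_ *m diag_mx _); apply/rowP => k; rewrite !mxE exprD.
Qed.

(** The eigenvalue at the index pair [(i, j)] depends only on i + j modulo 8, and each residue
    arises from 8 pairs. *)
Lemma Rmx_multiplicity (c : R[i]) (a : 'rV[R[i]]_8) x :
  has_multiplicity (c *: Rmx a) x
    (8 * \sum_(j < 8) ((c * (\sum_(k < 8) a 0%R k * (w ^+ j) ^+ k))%R == x))%N.
Proof.
have uP : fourier8 *t (1%:M : 'M_8) \in unitmx.
  by rewrite tensmx_unit ?unitmx1 ?fourier8_unit.
have -> : c *: Rmx a = \sum_(k < 8) (c * a 0 k) *: weyl8 ^+ k.
  by rewrite scaler_sumr; apply: eq_bigr => k _; rewrite scalerA.
have := has_multiplicity_diag x uP (mx_poly_diag (fun k => c * a 0 k) weyl8_diag).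
congr has_multiplicity.
rewrite (reindex (@mxtens_index 8 8)); last first.
  by exists (@mxtens_unindex 8 8) => k _; rewrite (mxtens_indexK, mxtens_unindexK).
pose G (j : 'I_8) : nat := ((c * (\sum_(k < 8) a 0%R k * (w ^+ j) ^+ k))%R == x).
transitivity (\sum_(i < 8) \sum_(j < 8) G (i + j)%R)%N.
  rewrite pair_bigA; apply: eq_bigr => [[i j]] _.
  congr (nat_of_bool (_ == _)); rewrite mxE mulr_sumr; apply: eq_bigr => k _.
  by rewrite mxE mxtens_indexK mulrA /= (prim_expr_mod w8_prim).
rewrite -[X in _ = (X * _)%N](card_ord 8) -sum_nat_const.
(* Translation by [i] permutes Z/8Z, so every inner sum is the full sum over residues. *)
apply: eq_bigr => i _; rewrite [RHS](reindex (fun j => i + j)) //=.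
by exists (fun j => j - i) => j _; rewrite /= ?subrK // addrC ?addKr ?subrK // addrK.
Qed.

End Spectrum.

(** Each position of [eig_list] is reached from two of the eight roots w^j, hence 16 = 8 * 2.
    Counting occurrences adds multiplicities when entries coincide. *)
Lemma Rhat_multiplicity (R : realType) m (t x : R[i]) : (1 <= m <= 8)%N ->
  has_multiplicity (Rhat m t) x (16 * count_mem x (eig_list (w8 R) t m)).
Proof.
move=> hm; have := Rmx_multiplicity ((Num.sqrt 8)%:C)%C^-1 (familyC m t) x.
congr has_multiplicity; rewrite -[16%N]/(8 * 2)%N -mulnA; congr (8 * _)%N.
pose s := eig_list (w8 R) t m.
transitivity (\sum_(j < 8) ((s`_(nth 0%N (eig_index m) j))%R == x))%N.
  apply: eq_bigr => j _; congr (nat_of_bool (_ == _)).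
  under eq_bigr do rewrite familyCE.
  rewrite family_coef_value ?w8_exp4 // sqrt8_w8 mulKf // -sqrt8_w8.
  by rewrite eq_complex /= eqxx andbT gt_eqF // sqrtr_gt0.
rewrite !big_ord_recl big_ord0 /=.
case: m hm @s => [|[|[|[|[|[|[|[|[|m]]]]]]]]] //= _.
(* Only how often each position occurs in [eig_index] matters, so the four comparisons with [x]
   become arbitrary naturals. *)
all: do 4!move: (nat_of_bool _) => ?; lia.
Qed.

(** * Braid representations *)

Section WeylBraid.
Variables (R : realType) (n : nat).
Local Notation w := (w8 R).

Definition weyl_at (i : 'I_n.-1) : 'M[R[i]]_(8 ^ n) := local_op (weyl8 R) i.

(** The Weyl commutation relation; the wrap-around of j + 1 modulo 8 is absorbed by w^8 = 1. *)
Lemma mul_Z8X8 : Z8 R *m X8 R = w *: (X8 R *m Z8 R).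
Proof.
apply/matrixP => i j; rewrite /Z8 mul_diag_mx mul_mx_diag !mxE.
case: eqP => [->|_]; rewrite ?mul0r ?mulr0 // mulr1 mul1r -exprS.
rewrite -[RHS](prim_expr_mod (w8_prim R)).
by rewrite -[LHS](prim_expr_mod (w8_prim R)) /= modn_mod addn1.
Qed.

Lemma weyl8_exp8 : weyl8 R ^+ 8 = 1.
Proof.
have uP : fourier8 R *t (1%:M : 'M_8) \in unitmx.
  by rewrite tensmx_unit ?unitmx1 ?fourier8_unit.
apply: (can_inj (mulmxK uP)); rewrite (mx_exp_diag 8 (weyl8_diag R)) mul1mx.
rewrite -[RHS]mulmx1; congr (_ *m _).
rewrite -diag_const_mx; congr diag_mx; apply/rowP => k.
by rewrite !mxE exprAC (prim_expr_order (w8_prim R)) expr1n.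
Qed.

Lemma weyl_at_exp8 i : weyl_at i ^+ 8 = 1.
Proof. by rewrite /weyl_at -local_opX weyl8_exp8 local_op1. Qed.

Lemma weyl_at_far (i j : 'I_n.-1) : (i.+1 < j)%N ->
  weyl_at i *m weyl_at j = weyl_at j *m weyl_at i.
Proof.
move=> ij; rewrite /weyl_at /weyl8 !local_opE !tens_prod_mul.
apply: eq_tens_prod => k _.
case: (eqVneq k i) => [->|ki].
  have [-> ->] : (i == j :> nat) = false /\ (i == j.+1 :> nat) = false by lia.
  by rewrite mulmx1 mul1mx.
case: (eqVneq k i.+1) => [->|ki1].
  have [-> ->] : (i.+1 == j) = false /\ (i.+1 == j.+1) = false by lia.
  by rewrite mulmx1 mul1mx.
by rewrite mulmx1 mul1mx.
Qed.

(** The supports meet only at position [j], where [weyl_at i] acts by [Z8] and [weyl_at j] by [X8];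
    the scalar comes from [mul_Z8X8]. *)
Lemma weyl_at_adj (i j : 'I_n.-1) : j = i.+1 :> nat ->
  weyl_at j *m weyl_at i = w ^+ 7 *: (weyl_at i *m weyl_at j).
Proof.
move=> ij; rewrite /weyl_at /weyl8 !local_opE !tens_prod_mul.
have w78 : w ^+ 7 * w = 1 by rewrite -exprSr (prim_expr_order (w8_prim R)).
set f := fun k => _; set g := (X in _ = _ *: X).
have -> : g = w *: tens_prod f n.
  rewrite /g (@tens_prod_scale _ _ f _ (fun k => if k == j then w else 1)).
    (* The only scalar that can differ from 1 sits at [j], read here as a position below [n]. *)
    rewrite -big_mkcond /= (bigD1 (widen_ord (leq_pred n) j)) //=.
    rewrite big1 ?mulr1 // => k /andP[/eqP kj]; case/eqP.
    exact: val_inj.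
  move=> k _; rewrite /f ij /=; case: (eqVneq k i) => [->|ki].
    have [-> ->] : (i == i.+1 :> nat) = false /\ (i == i.+2 :> nat) = false by lia.
    by rewrite mulmx1 mul1mx scale1r.
  case: (eqVneq k i.+1) => [_|ki1]; first by rewrite mul_Z8X8.
  by rewrite mulmx1 mul1mx scale1r.
by rewrite scalerA w78 scale1r.
Qed.
End WeylBraid.

(** * Matrix representations from the Artin presentation, and infinite image *)

Local Open Scope classical_set_scope.

Section BraidRep.
Variables (F : fieldType) (N n : nat) (L : 'I_n.-1 -> 'M[F]_N).
Hypothesis L_unit : forall i, L i \in unitmx.
Hypothesis L_far : forall i j : 'I_n.-1, (i.+1 < j)%N ->
  L i *m L j = L j *m L i.
Hypothesis L_adj : forall i j : 'I_n.-1, j = i.+1 :> nat ->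
  L i *m L j *m L i = L j *m L i *m L j.

Definition word_mx (u : braid_word n) : 'M[F]_N :=
  foldr (fun x M => (if x.2 then invmx (L x.1) else L x.1) *m M) 1%:M u.

Lemma word_mx_cat u v : word_mx (u ++ v) = word_mx u *m word_mx v.
Proof. by elim: u => [|x u IHu] /=; rewrite ?mul1mx // IHu mulmxA. Qed.

Lemma word_mx_unit u : word_mx u \in unitmx.
Proof.
elim: u => [|[i b] u IHu] /=; first exact: unitmx1.
by rewrite unitmx_mul IHu; case: b; rewrite ?unitmx_inv L_unit.
Qed.

Lemma word_mx_eq u v : braid_eq u v -> word_mx u = word_mx v.
Proof.
elim=> {u v} [//|u v _ -> //|u v x _ -> _ -> //|u u' v v' _ IHu _ IHv|i b|i j|i j].
- by rewrite !word_mx_cat IHu IHv.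
- by case: b; rewrite /= mulmx1 ?mulVmx ?mulmxV.
- by move=> ij; rewrite /= !mulmx1 L_far.
- by move=> ij; rewrite /= !mulmx1 !mulmxA L_adj.
Qed.

(** The word chosen by [repr] is evaluated; by [word_mx_eq] the value does not depend on the choice,
    which gives multiplicativity. *)
Lemma braid_rep_exists : exists rho : braid_group n -> 'M[F]_N,
  [/\ forall g, rho g \in unitmx, rho 1%g = 1%:M,
      forall g h, rho (g * h)%g = rho g *m rho h &
      forall i, rho (braid_gen i) = L i].
Proof.
exists (fun g => word_mx (repr g)).
split=> [g||g h|i]; first exact: word_mx_unit.
- exact: word_mx_eq (repr_pi_eq _).
- by rewrite -word_mx_cat; apply/word_mx_eq/repr_pi_eq.
- by rewrite (word_mx_eq (repr_pi_eq _)) /= mulmx1.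
Qed.
End BraidRep.

(** With the outer indices fixed at 0, the entries of [A] reappear among those of the local
    operator; [0 < d] provides these indices. *)
Lemma local_op_inj (F : fieldType) d n (i : 'I_n.-1) : (0 < d)%N ->
  injective (fun A : 'M[F]_(d * d) => @local_op F d n A i).
Proof.
move=> d0 A B; rewrite /local_op => /(can_inj (castmxK _ _)) /matrixP AB.
have x0 : 'I_(d ^ i) by apply: (Ordinal (n := d ^ i) (m := 0)); rewrite expn_gt0 d0.
have y0 : 'I_(d ^ (n - i.+2)).
  by apply: (Ordinal (n := d ^ (n - i.+2)) (m := 0)); rewrite expn_gt0 d0.
apply/matrixP => x y; have := AB (mxtens_index (mxtens_index (x0, x), y0))
  (mxtens_index (mxtens_index (x0, y), y0)).
by rewrite !tensmxE !mxE !eqxx !mul1r !mulr1.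
Qed.

(** By [local_op_inj] the image of the [k]-th power of the first generator determines [A ^+ k],
    which scales an eigenvector by [x ^+ k]; these scalars are pairwise distinct. *)
Lemma braid_rep_infinite (F : fieldType) d n (A : 'M[F]_(d * d)) x
    (rho : braid_group n -> 'M[F]_(d ^ n)) :
  (0 < d)%N -> (2 <= n)%N -> eigenvalue A x -> injective (GRing.exp x) ->
  is_braid_rep A rho -> infinite_set (range rho).
Proof.
case: n rho => [|[|n]] // rho d0 _ /eigenvalueP [v vA v0] injx [_ rho1 rhoM rhog].
pose i0 : 'I_n.+2.-1 := ord0; pose g := braid_gen i0.
have rhoX k : rho (g ^+ k)%g = local_op (A ^+ k) i0.
  rewrite local_opX; elim: k => [|k IHk]; first exact: rho1.
  by rewrite expgS rhoM IHk rhog exprS.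
have vX k : v *m A ^+ k = x ^+ k *: v.
  elim: k => [|k IHk]; first by rewrite mulmx1 scale1r.
  by rewrite exprS mulmxA vA -scalemxAl IHk scalerA -exprS.
have inj : injective (fun k => rho (g ^+ k)%g).
  move=> i j; rewrite !rhoX => /(local_op_inj d0) Aij; apply: injx.
  apply/eqP; rewrite -subr_eq0; have /eqP := vX i.
  by rewrite Aij vX -subr_eq0 -scalerBl scaler_eq0 (negPf v0) orbF -opprB oppr_eq0.
move=> fin; apply: infinite_nat.
rewrite -(eq_finite_set (@inj_card_eq _ _ [set: nat] _ (fun _ _ _ _ => @inj _ _))).
by apply: sub_finite_set fin => _ [k _ <-]; exists (g ^+ k)%g.
Qed.

Lemma mx_braid_scale (F : fieldType) N (c : F) (A B : 'M[F]_N) :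
  A *m B *m A = B *m A *m B ->
  (c *: A) *m (c *: B) *m (c *: A) = (c *: B) *m (c *: A) *m (c *: B).
Proof. by move=> AB; do 3!rewrite -?scalemxAl -?scalemxAr; rewrite AB. Qed.

Lemma mx_comm_sum (F : fieldType) N n c (p : 'I_n -> F) (U V : 'M[F]_N) :
  V *m U = U *m V ->
  let P (W : 'M[F]_N) := c *: \sum_k p k *: W ^+ k in P U *m P V = P V *m P U.
Proof.
move=> VU P; rewrite /P -!scalemxAl -!scalemxAr; congr (_ *: (_ *: _)).
rewrite mulmx_suml [RHS]mulmx_sumr; apply: eq_bigr => k _.
rewrite mulmx_sumr [RHS]mulmx_suml; apply: eq_bigr => l _.
rewrite -!scalemxAl -!scalemxAr !scalerA mulrC; congr (_ *: _).
by rewrite [RHS](@mx_qcommX _ _ _ _ 1) ?expr1n ?scale1r.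
Qed.

(** * Invertibility and braid relations for the local operators of [Rhat] *)

Section Main.
Variable R : realType.
Local Notation w := (w8 R).

Lemma w8_neq0 : w != 0.
Proof.
apply/eqP => w0; have /eqP := w8_exp4 R.
by rewrite w0 expr0n eq_sym oppr_eq0 oner_eq0.
Qed.

Lemma Rhat_eigenvalue m (t x : R[i]) : (1 <= m <= 8)%N ->
  eigenvalue (Rhat m t) x = (x \in eig_list w t m).
Proof.
move=> hm; rewrite (eigenvalueE (Rhat_multiplicity t x hm)) muln_gt0.
by rewrite -has_count has_pred1.
Qed.

Lemma Rhat_unit m (t : R[i]) : (1 <= m <= 8)%N -> t != 0 -> Rhat m t \in unitmx.
Proof.
move=> hm t0; have : ~~ eigenvalue (Rhat m t) 0.
  rewrite Rhat_eigenvalue // !inE !negb_or ![0 == _]eq_sym oppr_eq0.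
  have wX k : w ^+ k != 0 by rewrite expf_neq0 ?w8_neq0.
  by rewrite (wX 1%N) (wX 7%N) mulf_neq0 ?wX.
by rewrite /eigenvalue negbK /eigenspace kermx_eq0 raddf0 subr0 row_free_unit.
Qed.

(** Since [local_op] respects linear combinations and powers, the same polynomial is evaluated at
    [weyl_at R i], so the results on q-commuting matrices apply. *)
Lemma Rhat_local_op m t n (i : 'I_n.-1) :
  local_op (Rhat m t) i =
  ((Num.sqrt 8)%:C)%C^-1 *:
    (\sum_(k < 8) (family_coef w t m)`_k *: weyl_at R i ^+ k).
Proof.
rewrite /Rhat /Rmx scaler_sumr [RHS]scaler_sumr.
under eq_bigr do rewrite scalerA familyCE.
rewrite local_op_sum; apply: eq_bigr => k _.
by rewrite local_opX scalerA.
Qed.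

Lemma Rhat_adj m t n (i j : 'I_n.-1) : j = i.+1 :> nat ->
  let L (k : 'I_n.-1) : 'M[R[i]]_(8 ^ n) := local_op (Rhat m t) k in
  L i *m L j *m L i = L j *m L i *m L j.
Proof.
move=> ij /=; rewrite !Rhat_local_op.
apply: mx_braid_scale.
exact: (mx_braid_of_qcomm (p := fun k => (family_coef w t m)`_k) (weyl_at_exp8 R i)
  (weyl_at_exp8 R j) (weyl_at_adj R ij)
  (fun a b => family_coef_braid t m a b (w8_exp4 R))).
Qed.

Lemma Rhat_far m t n (i j : 'I_n.-1) : (i.+1 < j)%N ->
  let L (k : 'I_n.-1) : 'M[R[i]]_(8 ^ n) := local_op (Rhat m t) k in
  L i *m L j = L j *m L i.
Proof.
move=> ij /=; rewrite !Rhat_local_op.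
apply: (mx_comm_sum _ (fun k : 'I_8 => (family_coef w t m)`_k)).
exact/esym/weyl_at_far.
Qed.
End Main.

Theorem corollary5p4 (R : realType) (m : nat) (hm : (1 <= m <= 8)%N) :
  (exists zp zm xi : R[i],
    [/\ 8.-unity_root zp, 8.-unity_root zm, 8.-unity_root xi, zp != zm &
      forall t : R[i], `|t| = 1 ->
        let s := [:: zp; zm; xi * t; - (xi * t)] in
        [/\ forall x : R[i], eigenvalue (Rhat m t) x = (x \in s),
            uniq s -> forall x : R[i], x \in s -> has_multiplicity (Rhat m t) x 16 &
            forall x : R[i],
              has_multiplicity (Rhat m t) x (16 * count_mem x s)]])
  /\
  (forall t : R[i], `|t| = 1 -> (forall k : nat, (0 < k)%N -> t ^+ k != 1) ->
    forall n : nat, (2 <= n)%N ->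
      (exists rho : braid_group n -> 'M[R[i]]_(8 ^ n),
        is_braid_rep (Rhat m t) rho) /\
      (forall rho : braid_group n -> 'M[R[i]]_(8 ^ n),
        is_braid_rep (Rhat m t) rho -> infinite_set (range rho))).
Proof.
have root8 k : 8.-unity_root (w8 R ^+ k).
  by apply/unity_rootP; rewrite exprAC (prim_expr_order (w8_prim R)) expr1n.
split.
  exists (w8 R), (w8 R ^+ 7), (w8 R ^+ phase_exp m); split; first exact: (root8 1%N).
  - exact: root8.
  - exact: root8.
  - by rewrite -[X in X != _]expr1 (eq_prim_root_expr (w8_prim R)).
  move=> t t1 s; split=> [x|us x xs|x]; first exact: Rhat_eigenvalue.
    (* When the four values are distinct, each is counted once. *)
    by have := Rhat_multiplicity t x hm; rewrite -/s count_uniq_mem // xs.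
  exact: Rhat_multiplicity.
move=> t t1 tX n n2; have t0 : t != 0 by rewrite -normr_gt0 t1.
split.
  apply: braid_rep_exists => [i|i j|i j].
  - by rewrite local_op_unit ?Rhat_unit.
  - exact: Rhat_far.
  - exact: Rhat_adj.
(* The eigenvalues [w] and [w ^+ 7] have finite order, so xi t is the one that separates powers. *)
move=> rho; apply: (@braid_rep_infinite _ 8 n _ (w8 R ^+ phase_exp m * t)) => //.
  by rewrite Rhat_eigenvalue // !inE eqxx !orbT.
(* The phase is an eighth root of unity, so [x ^+ k = 1] would give [t ^+ (8 * k) = 1]. *)
set x := _ * t; have x8 : x ^+ 8 = t ^+ 8.
  by rewrite exprMn (unity_rootP (root8 _)) mul1r.
have x0 : x != 0.
  by rewrite mulf_neq0 ?expf_neq0 ?w8_neq0.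
suff lt i j : (i < j)%N -> x ^+ i != x ^+ j.
  by move=> i j; case: (ltngtP i j) => // /lt /eqP ne eq; case: ne.
move=> ij; apply/eqP => /eqP; rewrite -(subnKC (ltnW ij)) exprD.
rewrite -[X in X == _]mulr1 (inj_eq (mulfI _)) ?expf_neq0 // => /eqP xk.
have /eqP[] := tX (8 * (j - i))%N ltac:(by lia).
by rewrite exprM -x8 -exprM mulnC exprM -xk expr1n.
Qed.
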